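(* (Constructively.) For a countable signature, let $\mathcal M$ be a model admitting a Henkin environment $\rho:\mathbb N\to\mathcal M$. Then there is a model $\mathcal N$ whose domain is the (countable) type $\mathbb T$ of terms, together with an elementary embedding $\mathcal N\to\mathcal M$.
   Context: First-order logic without equality over a signature with countably many function and relation symbols; variables are de Bruijn indices $\mathsf x_n$, terms $\mathbb T$, formulas built from $\dot\bot$, atoms, $\dot\to,\dot\land,\dot\lor,\dot\forall,\dot\exists$ (a quantifier binds index $0$). A model is a type with interpretations of symbols; $\mathcal M\vDash_\rho\phi$ is Tarski satisfaction for $\rho:\mathbb N\to\mathcal M$, and for $a\in\mathcal M$, $\mathcal M\vDash_\rho\phi[a]$ means $\phi$ satisfied in the environment sending $\mathsf x_0\mapsto a$ and $\mathsf x_{k+1}\mapsto\rho\,k$ (so $\mathcal M\vDash_\rho\dot\forall\phi$ iff $\forall a.\,\mathcal M\vDash_\rho\phi[a]$). An environment $\rho:\mathbb N\to\mathcal M$ is a Henkin environment if for every formula $\phi$: there is $n$ with $\mathcal M\vDash_\rho\phi[\rho\,n]\to\mathcal M\vDash_\rho\dot\forall\phi$, and there is $n$ with $\mathcal M\vDash_\rho\dot\exists\phi\to\mathcal M\vDash_\rho\phi[\rho\,n]$. A map $h:\mathcal N\to\mathcal M$ is an elementary embedding if for all environments $\sigma:\mathbb N\to\mathcal N$ and formulas $\phi$, $\mathcal N\vDash_\sigma\phi\leftrightarrow\mathcal M\vDash_{h\circ\sigma}\phi$. *)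

(* Defs.v *)
From Stdlib Require Import Vector.

Set Implicit Arguments.
Unset Strict Implicit.
Unset Printing Implicit Defensive.

(* [option] lets finite and empty types be countable; equality on [X] is not
   required to be decidable. *)
Definition countable (X : Type) : Prop :=
  exists e : nat -> option X, forall x, exists n, e n = Some x.

Record signature := Signature {
  funs : Type;
  ar_fun : funs -> nat;
  rels : Type;
  ar_rel : rels -> nat }.

Definition countable_signature (S : signature) : Prop :=
  countable (funs S) /\ countable (rels S).

Inductive term (S : signature) : Type :=
| var : nat -> term S
| app : forall f : funs S, Vector.t (term S) (ar_fun f) -> term S.

(* De Bruijn: [fAll] and [fEx] bind index 0 of their argument. *)
Inductive form (S : signature) : Type :=
| fBot : form S
| fAtom : forall P : rels S, Vector.t (term S) (ar_rel P) -> form S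
| fImp : form S -> form S -> form S
| fAnd : form S -> form S -> form S
| fOr : form S -> form S -> form S
| fAll : form S -> form S
| fEx : form S -> form S.

Arguments fBot {S}.

Record interp (S : signature) (D : Type) := Interp {
  i_fun : forall f : funs S, Vector.t D (ar_fun f) -> D;
  i_rel : forall P : rels S, Vector.t D (ar_rel P) -> Prop }.

Record model (S : signature) := Model {
  dom :> Type;
  dom_interp : interp S dom }.

Definition env (D : Type) : Type := nat -> D.

Definition scons (D : Type) (a : D) (rho : env D) : env D :=
  fun n => match n with 0 => a | Datatypes.S k => rho k end.

Fixpoint eval (S : signature) (M : model S) (rho : env M) (t : term S) : M :=
  match t with
  | var _ n => rho n
  | app v => i_fun (dom_interp M) (Vector.map (eval rho) v)
  end.

Fixpoint sat (S : signature) (M : model S) (rho : env M) (phi : form S) : Prop :=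
  match phi with
  | fBot => False
  | fAtom v => i_rel (dom_interp M) (Vector.map (eval rho) v)
  | fImp phi psi => sat rho phi -> sat rho psi
  | fAnd phi psi => sat rho phi /\ sat rho psi
  | fOr phi psi => sat rho phi \/ sat rho psi
  | fAll phi => forall a : M, sat (scons a rho) phi
  | fEx phi => exists a : M, sat (scons a rho) phi
  end.

Definition sat_at (S : signature) (M : model S) (rho : env M) (phi : form S)
  (a : M) : Prop := sat (scons a rho) phi.

Definition henkin_env (S : signature) (M : model S) (rho : env M) : Prop :=
  forall phi : form S,
    (exists n, sat_at rho phi (rho n) -> sat rho (fAll phi)) /\
    (exists n, sat rho (fEx phi) -> sat_at rho phi (rho n)).

Definition elementary_embedding (S : signature) (N M : model S) (h : N -> M)
  : Prop :=
  forall (sigma : env N) (phi : form S),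
    sat sigma phi <-> sat (fun n => h (sigma n)) phi.

(* Main.v *)
(* On terms, interpret every function symbol by itself and every relation by
   its meaning in [M] under the Henkin environment [rho]; the embedding is
   evaluation under [rho].  By the substitution lemma the universal case asks
   to pass from [phi[sigma]] holding at all values of terms to its holding at all
   elements of [M], and the existential case asks for a witness that is the value
   of a term.  The Henkin condition reduces both to some [rho n], which is the
   value of the variable [n]. *)

Require Import Defs.
From Stdlib Require Import Vector Cantor Lia.

Set Implicit Arguments.
Unset Strict Implicit.

(* The automatic induction principle has no hypothesis for the argument
   vector of [app]. *)
Fixpoint term_nested_ind (Sg : signature) (P : term Sg -> Prop)
    (Hvar : forall n, P (var Sg n))
    (Happ : forall f (v : Vector.t (term Sg) (ar_fun f)),
      Vector.Forall P v -> P (app v))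
    (t : term Sg) : P t :=
  match t with
  | var _ n => Hvar n
  | @app _ f v =>
      Happ f v
        ((fix all m (w : Vector.t (term Sg) m) : Vector.Forall P w :=
            match w with
            | Vector.nil _ => Vector.Forall_nil P
            | Vector.cons _ t _ w' =>
                Vector.Forall_cons P t w'
                  (term_nested_ind Hvar Happ t) (all _ w')
            end) _ v)
  end.

Lemma map_ext_Forall (A B : Type) (f g : A -> B) m (v : Vector.t A m) :
  Vector.Forall (fun x => f x = g x) v -> Vector.map f v = Vector.map g v.
Proof.
  induction 1 as [|m x v Hx _ IH]; simpl; [reflexivity|].
  now rewrite Hx, IH.
Qed.

(** Iterated pairing: each entry splits off a code for the head from a code for the tail, and every
    number codes the empty vector. *)
Fixpoint decode_vector (X : Type) (d : nat -> option X) (m n : nat)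
  : option (Vector.t X m) :=
  match m with
  | 0 => Some (Vector.nil X)
  | S m' =>
      let (i, j) := Cantor.of_nat n in
      match d i, decode_vector d m' j with
      | Some x, Some v => Some (Vector.cons X x m' v)
      | _, _ => None
      end
  end.

(* [k] bounds the depth of the decoded term. *)
Fixpoint decode_term (Sg : signature) (e : nat -> option (funs Sg)) (k n : nat)
  : option (term Sg) :=
  match k with
  | 0 => None
  | S k' =>
      match Cantor.of_nat n with
      | (0, i) => Some (var Sg i)
      | (S i, j) =>
          match e i with
          | Some f =>
              option_map (@app Sg f) (decode_vector (decode_term e k') (ar_fun f) j)
          | None => None
          end
      end
  end.

(** The finitely many depth bounds add up to a common one. The decoder takes the bound [k] because
    it will be [decode_term e]. *)
Lemma decode_vector_surj (X : Type) (d : nat -> nat -> option X) m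
    (v : Vector.t X m) :
  Vector.Forall
    (fun x => exists K n, forall k, K <= k -> d k n = Some x) v ->
  exists K n, forall k, K <= k -> decode_vector (d k) m n = Some v.
Proof.
  induction 1 as [|m x v (K1 & n1 & H1) _ (K2 & n2 & H2)].
  - now exists 0, 0.
  - exists (K1 + K2), (Cantor.to_nat (n1, n2)); intros k Hk.
    cbn [decode_vector]; rewrite Cantor.cancel_of_to.
    now rewrite H1, H2 by lia.
Qed.

(* Stating the result for all large depths [k] makes the bounds of the
   arguments of a function symbol compatible. *)
Lemma decode_term_surj (Sg : signature) (e : nat -> option (funs Sg))
    (He : forall f, exists n, e n = Some f) (t : term Sg) :
  exists K n, forall k, K <= k -> decode_term e k n = Some t.
Proof.
  induction t as [i|f v IH] using term_nested_ind.
  (* Tag [0] marks variables, tag [S i] the function symbol [e i]; depth [0] decodes nothing, so the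
     bound starts at [1]. *)
  - exists 1, (Cantor.to_nat (0, i)); intros [|k] Hk; [lia|].
    cbn [decode_term]; now rewrite Cantor.cancel_of_to.
  - destruct (He f) as [i Hi].
    destruct (decode_vector_surj IH) as (K & j & Hj).
    exists (S K), (Cantor.to_nat (S i, j)); intros [|k] Hk; [lia|].
    cbn [decode_term]; rewrite Cantor.cancel_of_to, Hi.
    now rewrite Hj by lia.
Qed.

(** Pairing a depth with a code merges the decoders of all depths into one enumeration. *)
Lemma countable_term (Sg : signature) :
  countable (funs Sg) -> countable (term Sg).
Proof.
  intros [e He].
  exists (fun n => let (k, m) := Cantor.of_nat n in decode_term e k m).
  intros t; destruct (decode_term_surj He t) as (K & n & H).
  exists (Cantor.to_nat (K, n)); rewrite Cantor.cancel_of_to; auto.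
Qed.

Fixpoint subst_term (Sg : signature) (sigma : nat -> term Sg) (t : term Sg)
  : term Sg :=
  match t with
  | var _ n => sigma n
  | app v => app (Vector.map (subst_term sigma) v)
  end.

Definition up (Sg : signature) (sigma : nat -> term Sg) : nat -> term Sg :=
  scons (var Sg 0) (fun n => subst_term (fun k => var Sg (S k)) (sigma n)).

Fixpoint subst_form (Sg : signature) (sigma : nat -> term Sg) (phi : form Sg)
  : form Sg :=
  match phi with
  | fBot => fBot
  | fAtom v => fAtom (Vector.map (subst_term sigma) v)
  | fImp phi psi => fImp (subst_form sigma phi) (subst_form sigma psi)
  | fAnd phi psi => fAnd (subst_form sigma phi) (subst_form sigma psi)
  | fOr phi psi => fOr (subst_form sigma phi) (subst_form sigma psi)
  | fAll phi => fAll (subst_form (up sigma) phi)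
  | fEx phi => fEx (subst_form (up sigma) phi)
  end.

(* The environment is taken up to pointwise equality, which avoids function
   extensionality. *)
Lemma eval_subst (Sg : signature) (M : model Sg) (rho tau : env M)
    (sigma : nat -> term Sg) :
  (forall n, eval rho (sigma n) = tau n) ->
  forall t, eval rho (subst_term sigma t) = eval tau t.
Proof.
  intros H t; induction t as [n|f v IH] using term_nested_ind; simpl; [apply H|].
  f_equal; rewrite Vector.map_map; now apply map_ext_Forall.
Qed.

Lemma eval_up (Sg : signature) (M : model Sg) (rho tau : env M)
    (sigma : nat -> term Sg) (a : M) :
  (forall n, eval rho (sigma n) = tau n) ->
  forall n, eval (scons a rho) (up sigma n) = scons a tau n.
Proof.
  intros H [|n]; simpl; [reflexivity|].
  rewrite <- H; now apply eval_subst.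
Qed.

(** Induction on [phi] with environments and substitution general: a binder extends the former and
    lifts the latter, and [eval_up] restores the hypothesis. *)
Lemma sat_subst (Sg : signature) (M : model Sg) (phi : form Sg) :
  forall (rho tau : env M) (sigma : nat -> term Sg),
    (forall n, eval rho (sigma n) = tau n) ->
    sat rho (subst_form sigma phi) <-> sat tau phi.
Proof.
  induction phi as [|P v|phi IH1 psi IH2|phi IH1 psi IH2|phi IH1 psi IH2
                   |phi IH|phi IH]; intros rho tau sigma H; simpl.
  2: { rewrite Vector.map_map.
       now rewrite (Vector.map_ext _ _ _ _ (eval_subst H)). }
  2-4: now rewrite (IH1 rho tau sigma H), (IH2 rho tau sigma H).
  - reflexivity.
  - split; intros Ha a; specialize (Ha a);
      now apply (IH _ _ _ (eval_up a H)).
  - split; intros [a Ha]; exists a; now apply (IH _ _ _ (eval_up a H)).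
Qed.

Section SyntacticModel.

Variables (Sg : signature) (M : model Sg) (rho : env M).

Definition syntactic_interp : interp Sg (term Sg) :=
  {| i_fun := @app Sg;
     i_rel := fun P v => i_rel (dom_interp M) (Vector.map (eval rho) v) |}.

Definition syntactic_model : model Sg := Model syntactic_interp.

(** Function symbols act as term constructors, so an environment of the syntactic model is the same
    thing as a substitution. *)
Lemma eval_syntactic (sigma : env syntactic_model) (t : term Sg) :
  eval sigma t = subst_term sigma t.
Proof.
  induction t as [n|f v IH] using term_nested_ind; simpl; [reflexivity|].
  f_equal; now apply map_ext_Forall.
Qed.

Lemma eval_scons_term (sigma : env syntactic_model) (t : syntactic_model)
    (nu : env M) :
  (forall n, eval rho (sigma n) = nu n) ->
  forall n, eval rho (scons t sigma n) = scons (eval rho t) nu n.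
Proof. now intros H [|n]; simpl. Qed.

Lemma sat_syntactic (phi : form Sg) :
  henkin_env rho ->
  forall (sigma : env syntactic_model) (tau : env M),
    (forall n, eval rho (sigma n) = tau n) ->
    sat sigma phi <-> sat tau phi.
Proof.
  intros Henkin.
  induction phi as [|P v|phi IH1 psi IH2|phi IH1 psi IH2|phi IH1 psi IH2
                   |phi IH|phi IH]; intros sigma tau H; simpl.
  2: { rewrite Vector.map_map.
       rewrite (Vector.map_ext _ _ _ (eval tau)); [reflexivity|].
       intros t; rewrite eval_syntactic; now apply eval_subst. }
  2-4: now rewrite (IH1 sigma tau H), (IH2 sigma tau H).
  - reflexivity.
  - split; intros Hall.
    (* The Henkin condition concerns [rho] only, so [sigma] is substituted into the formula to trade
       [tau] for [rho]; under the binder this becomes [up sigma]. *)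
    + apply (@sat_subst _ _ (fAll phi) rho tau sigma H).
      destruct (Henkin (subst_form (up sigma) phi)) as [[n Hn] _].
      apply Hn, (sat_subst phi (eval_up (rho n) H)).
      apply (IH (scons (var Sg n) sigma)); [|apply Hall].
      now apply eval_scons_term.
    + intros t; apply (IH _ (scons (eval rho t) tau)); [|apply Hall].
      now apply eval_scons_term.
  - split.
    + intros [t Ht]; exists (eval rho t); revert Ht; apply IH.
      now apply eval_scons_term.
    + intros Hex; apply (@sat_subst _ _ (fEx phi) rho tau sigma H) in Hex.
      destruct (Henkin (subst_form (up sigma) phi)) as [_ [n Hn]].
      apply Hn, (sat_subst phi (eval_up (rho n) H)) in Hex.
      exists (var Sg n); revert Hex; apply IH.
      now apply eval_scons_term.
Qed.

End SyntacticModel.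

Theorem theorem3p5 (S : signature) (HS : countable_signature S)
    (M : model S) (HM : exists rho : env M, henkin_env rho) :
  countable (term S) /\
  exists (I : interp S (term S)) (h : Model I -> M), elementary_embedding h.
Proof.
  split; [apply countable_term, HS|].
  destruct HM as [rho Henkin].
  (* With [tau] the composite of [eval rho] and [sigma], the pointwise hypothesis of [sat_syntactic]
     holds by reflexivity. *)
  exists (syntactic_interp rho), (eval rho); intros sigma phi.
  now apply sat_syntactic.
Qed.
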